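(* Let $\Pi=(X,U,F,G,g)$ be an optimal control problem with value function $V$ such that $X$ is a proper metric space, $U$ is a compact metric space, $F$ is compact-valued, and $g$, $G$ and $F$ are upper semi-continuous. For every $i\in\mathbb{N}$, let $\Pi_i=(X_i,U_i,F_i,G_i,g_i)$ be an abstraction of conservatism $\rho_i\in\mathbb{R}_+\cup\{\infty\}$ of $\Pi$, let $C_i$ be an optimal controller for $\Pi_i$, and let $L_i$ be the closed-loop value function of $\Pi$ associated with $C_i\circ\mathop{\in}$, where $\mathop{\in}\colon X\rightrightarrows X_i$ is the membership relation. Suppose $\lim_{i\to\infty}\rho_i=0$. Suppose further that, for some $\lambda\in\mathbb{R}_+$, the cost functions $g$ and $G$ and, for every $i\in\mathbb{N}$, the cost functions $g_i$ and $G_i$ map into the set $\lambda\mathbb{Z}_+\cup\{\infty\}$. Then for every compact subset $N\subseteq X$ we have $\sup L_i(N)=\sup V(N)$ for all sufficiently large $i\in\mathbb{N}$. In particular, if $\lambda=0$ and $V$ vanishes on some compact subset $N\subseteq X$, so does $L_i$ for all sufficiently large $i\in\mathbb{N}$.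
   Context: Conventions: $\mathbb{R}_+=[0,\infty)$, $\mathbb{Z}_+=\{0,1,2,\dots\}$, $\mathbb{N}=\{1,2,\dots\}$; $\infty+x=\infty$ for $x\in\mathbb{R}$; $\sup\emptyset=0$; $A^B$ is the set of maps $B\to A$. A set-valued map $f\colon A\rightrightarrows B$ assigns to each $a\in A$ a subset $f(a)\subseteq B$ and is identified with the relation $\{(a,b): b\in f(a)\}$; it is strict if $f(a)\neq\emptyset$ for all $a$. Images of sets are written $f(C)=\bigcup_{a\in C}f(a)$, and similarly for several arguments, e.g. $F_1(\Omega,u)=\bigcup_{p\in\Omega}F_1(p,u)$, $g_1(\Omega,\Omega',u)=\{g_1(p,p',u):p\in\Omega,p'\in\Omega'\}$. In a metric space $(X,d)$, $\bar B(c,r)$ is the closed ball, with $\bar B(c,0)=\{c\}$; for a set $M$, $\bar B(M,r)=\bigcup_{c\in M}\bar B(c,r)$; $d(M,N)=\inf\{d(x,y):x\in M,y\in N\}$; $\operatorname{diam}$ is the diameter. A metric space is proper if every closed ball is compact. A function $f\colon X\to[-\infty,\infty]$ on a metric space is upper semi-continuous if $\{(x,\gamma)\in X\times\mathbb{R}:\gamma\le f(x)\}$ is closed; a set-valued $f\colon A\rightrightarrows B$ between metric spaces is upper semi-continuous if $\{a: f(a)\cap\Omega\neq\emptyset\}$ is closed for every closed $\Omega\subseteq B$. System: a triple $(X,U,F)$ with nonempty sets $X,U$ and strict $F\colon X\times U\rightrightarrows X$. A pair $(u,x)\in U^{\mathbb{Z}_+}\times X^{\mathbb{Z}_+}$ is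 a solution of it if $x(t+1)\in F(x(t),u(t))$ for all $t\in\mathbb{Z}_+$. Controller for $(X,U,F)$: a quintuple $C=(Z,Z_0,\widetilde X,\widetilde U,H)$ of nonempty sets $Z,Z_0,\widetilde X,\widetilde U$ with $Z_0\subseteq Z$, $X\subseteq\widetilde X$, $\widetilde U\subseteq U$, and a strict map $H\colon Z\times\widetilde X\rightrightarrows Z\times\widetilde U\times\{0,1\}$. A quadruple $(u,v,z,x)\in\widetilde U^{\mathbb{Z}_+}\times\{0,1\}^{\mathbb{Z}_+}\times Z^{\mathbb{Z}_+}\times\widetilde X^{\mathbb{Z}_+}$ is a solution of $C$ if $z(0)\in Z_0$ and $(z(t+1),u(t),v(t))\in H(z(t),x(t))$ for all $t\in\mathbb{Z}_+$. $\mathcal{F}(X,U)$ denotes the collection of all controllers for $(X,U,F)$. Behavior: for a system $S=(X,U,F)$ and $C\in\mathcal{F}(X,U)$, $\mathcal{B}(C\times S)$ is the set of $(u,v,x)\in(U\times\{0,1\}\times X)^{\mathbb{Z}_+}$ for which there is $z\colon\mathbb{Z}_+\to Z$ such that $(u,v,z,x)$ is a solution of $C$ and $(u,x)$ is a solution of $S$; $\mathcal{B}_p(C\times S)=\{(u,v,x)\in\mathcal{B}(C\times S): x(0)=p\}$. Optimal control problem: a tuple $(X,U,F,G,g)$ where $(X,U,F)$ is a system, $G\colon X\to\mathbb{R}_+\cup\{\infty\}$ (terminal cost) and $g\colon X\times X\times U\to\mathbb{R}_+\cup\{\infty\}$ (running cost). Its cost functional $J\colon(U\times\{0,1\}\times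 X)^{\mathbb{Z}_+}\to[0,\infty]$ is $J(u,v,x)=G(x(T))+\sum_{t=0}^{T-1}g(x(t),x(t+1),u(t))$ if $v\neq0$, where $T=\min v^{-1}(1)$, and $J(u,v,x)=\infty$ if $v=0$. With $S=(X,U,F)$, the closed-loop value function associated with $C\in\mathcal{F}(X,U)$ is $L(p)=\sup_{(u,v,x)\in\mathcal{B}_p(C\times S)}J(u,v,x)$, and the value function is $V(p)=\inf_{C\in\mathcal{F}(X,U)}\sup_{(u,v,x)\in\mathcal{B}_p(C\times S)}J(u,v,x)$. A controller $C\in\mathcal{F}(X,U)$ is optimal for the problem if the closed-loop value function associated with $C$ coincides with the value function. Serial composition: for a controller $C=(Z,Z_0,\widetilde X,\widetilde U,H)$, a nonempty set $X'$ and a strict map $Q\colon X'\rightrightarrows\widetilde X$, $C\circ Q$ is the controller $(Z,Z_0,X',\widetilde U,H')$ with $H'(z,x')=\bigcup_{y\in Q(x')}H(z,y)$. Abstraction: let $\Pi_i=(X_i,U_i,F_i,G_i,g_i)$, $i=1,2$, be optimal control problems, where $X_2$ is a cover of $X_1$ (a set of subsets of $X_1$ with union $X_1$) by non-empty subsets. $\Pi_2$ is an abstraction of $\Pi_1$ if the membership relation $Q=\mathop{\in}\colon X_1\rightrightarrows X_2$, $\mathop{\in}(p)=\{\Omega\in X_2:p\in\Omega\}$, is a valuated feedback refinement relation from $\Pi_1$ to $\Pi_2$, i.e. $Q$ is strict and for all $(p_1,p_2),(q_1,q_2)\in Q$ and $u\in U_2$: $U_2\subseteq U_1$; $G_1(p_1)\le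 G_2(p_2)$; $g_1(p_1,q_1,u)\le g_2(p_2,q_2,u)$; $Q(F_1(p_1,u))\subseteq F_2(p_2,u)$. Conservatism: let $\Pi_2$ be an abstraction of $\Pi_1$, let $U_1,X_1$ be metric spaces ($d$ the metric on $X_1$), and let the elements of $X_2$ be closed subsets of $X_1$. Then $\Pi_2$ is an abstraction of conservatism $\infty$ of $\Pi_1$. It is an abstraction of conservatism $\rho\in\mathbb{R}_+$ of $\Pi_1$ if for all $\Omega,\Omega'\in X_2$ and $u\in U_2$: (i) $U_1=\bar B(U_2,\rho)$; (ii) $G_2(\Omega)\le\rho+\sup G_1(\Omega)$; (iii) $g_2(\Omega,\Omega',u)\le\rho+\sup g_1(\Omega,\Omega',u)$; and, if $\Omega$ satisfies $G_1(\Omega)\cup g_1(\Omega,X_1,U_1)\neq\{\infty\}$, additionally (iv) $F_2(\Omega,u)\subseteq\{\Omega''\in X_2: d(\Omega'',F_1(\Omega,u))\le\rho\}$; (v) $\operatorname{diam}(\Omega)\le\rho$. *)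

(* Defs.v *)
From HB Require Import structures.
From mathcomp Require Import all_boot all_order all_algebra.
From mathcomp Require Import all_classical all_reals all_analysis.
Import Order.TTheory GRing.Theory Num.Theory.
Import numFieldNormedType.Exports.

Set Implicit Arguments.
Unset Strict Implicit.
Unset Printing Implicit Defensive.

Local Open Scope classical_set_scope.
Local Open Scope ring_scope.
Local Open Scope ereal_scope.

(* A "set" of the theory is a [set T] over an ambient type [T], so that
   inclusions such as U2 `<=` U1 and families of subsets are literal.  Functions
   on a set are total on the ambient type; only their values on the set matter. *)

Section SupAndMetric.
Context {R : realType}.

(* Supremum in [0, +oo], with nnsup set0 = 0. *)
Definition nnsup (A : set \bar R) : \bar R := ereal_sup (0 |` A).

Context {T : metricType R}.

(* The library's [closed_ball] is the closure of the open ball, which may be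
   smaller than the closed ball of a general metric space. *)
Definition cball (c : T) (r : R) : set T := [set y | (mdist c y <= r)%R].

Definition cball_set (M : set T) (r : R) : set T := \bigcup_(c in M) cball c r.

Definition proper_metric : Prop := forall c r, compact (cball c r).

Definition set_dist (M N : set T) : \bar R :=
  ereal_inf [set (mdist x y)%:E | x in M & y in N].

Definition diam (M : set T) : \bar R :=
  nnsup [set (mdist x y)%:E | x in M & y in M].

End SupAndMetric.
Arguments proper_metric {R} T.

Definition usc_fun {R : realType} {T : topologicalType} (f : T -> \bar R) :=
  closed [set xc : T * R | xc.2%:E <= f xc.1].

Definition usc_setval {A B : topologicalType} (f : A -> set B) :=
  forall O : set B, closed O -> closed [set a | f a `&` O !=set0].

Record system (TX TU : Type) (X : set TX) (U : set TU) := System {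
  trans :> TX -> TU -> set TX;
  states_nonempty : X !=set0;
  inputs_nonempty : U !=set0;
  trans_strict : forall p u, X p -> U u -> trans p u !=set0;
  trans_sub : forall p u, X p -> U u -> trans p u `<=` X
}.

Definition sys_solution TX TU (X : set TX) (U : set TU) (S : system X U)
    (u : nat -> TU) (x : nat -> TX) : Prop :=
  [/\ forall t, U (u t), forall t, X (x t) & forall t, S (x t) (u t) (x t.+1)].

(* A candidate controller.  Its state set Z and its measurement set X~ are
   arbitrary types; the inclusion of the plant's state set into X~ is represented
   by an embedding, which [is_controller] requires to be injective. *)
Record controller (TX TU : Type) := Controller {
  ctl_state : Type;
  ctl_init : set ctl_state;
  ctl_meas : Type;
  ctl_emb : TX -> ctl_meas;
  ctl_input : set TU;
  ctl_map : ctl_state -> ctl_meas -> set (ctl_state * TU * bool)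
}.
Arguments ctl_state {TX TU} c.
Arguments ctl_init {TX TU} c.
Arguments ctl_meas {TX TU} c.
Arguments ctl_emb {TX TU} c.
Arguments ctl_input {TX TU} c.
Arguments ctl_map {TX TU} c.

(* Membership in the collection F(X, U). *)
Definition is_controller TX TU (X : set TX) (U : set TU)
    (C : controller TX TU) : Prop :=
  [/\ ctl_init C !=set0,
      {in X &, injective (ctl_emb C)},
      ctl_input C !=set0 /\ ctl_input C `<=` U,
      forall z y, ctl_map C z y !=set0 &
      forall z y, ctl_map C z y `<=` [set w | ctl_input C w.1.2]].

Definition ctl_solution TX TU (C : controller TX TU) (u : nat -> TU)
    (v : nat -> bool) (z : nat -> ctl_state C) (y : nat -> ctl_meas C) : Prop :=
  [/\ forall t, ctl_input C (u t), ctl_init C (z 0%N) &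
      forall t, ctl_map C (z t) (y t) (z t.+1, u t, v t)].

Definition behavior TX TU (X : set TX) (U : set TU)
    (C : controller TX TU) (S : system X U) :
    set ((nat -> TU) * (nat -> bool) * (nat -> TX)) :=
  [set w | let: (u, v, x) := w in
     (exists z, ctl_solution u v z (ctl_emb C \o x)) /\ sys_solution S u x].

Definition behavior_from TX TU (X : set TX) (U : set TU)
    (C : controller TX TU) (S : system X U) (p : TX) :
    set ((nat -> TU) * (nat -> bool) * (nat -> TX)) :=
  behavior C S `&` [set w | w.2 0%N = p].

(* Serial composition C o Q; the new measurement set is the type TX'. *)
Definition serial TX TU (C : controller TX TU) (TX' : Type)
    (Q : TX' -> set (ctl_meas C)) : controller TX' TU :=
  {| ctl_state := ctl_state C;
     ctl_init := ctl_init C;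
     ctl_meas := TX';
     ctl_emb := id;
     ctl_input := ctl_input C;
     ctl_map := fun z x' => \bigcup_(y in Q x') ctl_map C z y |}.
Arguments serial {TX TU} C {TX'} Q.

Record ocp (R : realType) (TX TU : Type) (X : set TX) (U : set TU) := Ocp {
  sys :> system X U;
  term_cost : TX -> \bar R;
  run_cost : TX -> TX -> TU -> \bar R;
  term_cost_ge0 : forall p, X p -> 0 <= term_cost p;
  run_cost_ge0 : forall p q u, X p -> X q -> U u -> 0 <= run_cost p q u
}.

Section OptimalControl.
Context {R : realType} {TX TU : Type} {X : set TX} {U : set TU}.
Variable P : ocp R X U.

Definition cost (w : (nat -> TU) * (nat -> bool) * (nat -> TX)) : \bar R :=
  let: (u, v, x) := w in
  match pselect (exists t, v t) with
  | left stops =>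
      let T := ex_minn stops in
      term_cost P (x T) + \sum_(0 <= t < T) run_cost P (x t) (x t.+1) (u t)
  | right _ => +oo
  end.

Definition closed_loop_value (C : controller TX TU) (p : TX) : \bar R :=
  nnsup [set cost w | w in behavior_from C P p].

Definition value (p : TX) : \bar R :=
  ereal_inf [set e | exists C : controller TX TU,
                       is_controller X U C /\ e = closed_loop_value C p].

Definition optimal (C : controller TX TU) : Prop :=
  is_controller X U C /\ forall p, X p -> closed_loop_value C p = value p.

Definition costs_in (A : set \bar R) : Prop :=
  (forall p, X p -> A (term_cost P p)) /\
  (forall p q u, X p -> X q -> U u -> A (run_cost P p q u)).

End OptimalControl.

Definition vfrr (R : realType) (TX1 TX2 TU : Type)
    (X1 : set TX1) (X2 : set TX2) (U1 U2 : set TU)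
    (Q : TX1 -> set TX2) (P1 : ocp R X1 U1) (P2 : ocp R X2 U2) : Prop :=
  [/\ forall p, X1 p -> Q p !=set0 /\ Q p `<=` X2,
      U2 `<=` U1,
      forall p1 p2, X1 p1 -> Q p1 p2 -> term_cost P1 p1 <= term_cost P2 p2,
      forall p1 p2 q1 q2 u, X1 p1 -> Q p1 p2 -> X1 q1 -> Q q1 q2 -> U2 u ->
        run_cost P1 p1 q1 u <= run_cost P2 p2 q2 u &
      forall p1 p2 u, X1 p1 -> Q p1 p2 -> U2 u ->
        \bigcup_(q in P1 p1 u) Q q `<=` P2 p2 u].

(* The membership relation, as a set-valued map into the cover. *)
Definition memb (T : Type) (X2 : set (set T)) (p : T) : set (set T) :=
  [set O | X2 O /\ O p].

Definition abstraction (R : realType) (TX TU : Type)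
    (X1 : set TX) (X2 : set (set TX)) (U1 U2 : set TU)
    (P2 : ocp R X2 U2) (P1 : ocp R X1 U1) : Prop :=
  [/\ \bigcup_(O in X2) O = X1,
      forall O, X2 O -> O !=set0 &
      vfrr (memb X2) P1 P2].

Definition finite_conservatism (R : realType) (X U : metricType R)
    (X2 : set (set X)) (U2 : set U)
    (P2 : ocp R X2 U2) (P1 : ocp R [set: X] [set: U]) (rho : R) : Prop :=
  forall (O O' : set X) (u : U), X2 O -> X2 O' -> U2 u ->
  [/\ [set: U] = cball_set U2 rho,
      term_cost P2 O <= rho%:E + nnsup (term_cost P1 @` O),
      run_cost P2 O O' u <=
        rho%:E + nnsup [set run_cost P1 p p' u | p in O & p' in O'] &
      (term_cost P1 @` O) `|`
        [set e | exists p q w, O p /\ e = run_cost P1 p q w] <> [set +oo] ->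
      P2 O u `<=` [set O'' | X2 O'' /\
                     set_dist O'' (\bigcup_(p in O) P1 p u) <= rho%:E]
      /\ diam O <= rho%:E].

(* [P2] is an abstraction of conservatism rho of [P1], for rho in [0, +oo]. *)
Definition abstraction_of_conservatism (R : realType) (X U : metricType R)
    (X2 : set (set X)) (U2 : set U)
    (P2 : ocp R X2 U2) (P1 : ocp R [set: X] [set: U]) (rho : \bar R) : Prop :=
  [/\ abstraction P2 P1,
      forall O, X2 O -> closed O &
      match rho with
      | r%:E => (0 <= r)%R /\ finite_conservatism P2 P1 r
      | +oo => True
      | -oo => False
      end].

(* The set (lambda Z_+) U {+oo}. *)
Definition multiples (R : realType) (lambda : R) : set \bar R :=
  [set e | e = +oo \/ exists k : nat, e = (lambda * k%:R)%:E].

(* Main.v *)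
Require Import Defs.
From HB Require Import structures.
From mathcomp Require Import all_boot all_order all_algebra.
From mathcomp Require Import all_classical all_reals all_analysis.
Import Order.TTheory GRing.Theory Num.Theory.
Import numFieldNormedType.Exports.

Set Implicit Arguments.
Unset Strict Implicit.
Unset Printing Implicit Defensive.

Local Open Scope classical_set_scope.
Local Open Scope ring_scope.
Local Open Scope ereal_scope.

(** Since all costs are multiples of [lambda], a bound [lambda * n] on the
    worst-case cost can be handled as a natural number budget [n], and dynamic
    programming becomes an inductive predicate: [win k n p] says that from [p]
    one can stop within [k] steps while spending at most [n], whatever successors
    the plant chooses.  The theorem follows from three properties of [win].

    - Soundness, [win_value]: [win k n p] gives [value p <= lambda * n].  The
      controller has no memory: it reads off the lexicographically least pair
      (budget, number of steps) that wins at the current state and makes the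
      corresponding move, and that pair decreases along every run.

    - Completeness, [value_lt_win]: if no [k] makes [win k n p] true, then every
      controller has a run from [p] whose cost is above the budget.  The reason is
      compactness: upper semi-continuity and the lattice of cost values make
      [win k n] open ([win_open]), so if all successors in the compact set
      [F(p, u)] were winning, they would win within a common number of steps.
      Hence some successor is losing for the remaining budget, and the plant can
      keep the run losing forever ([lose_step], [lose_cost]).

    - Robustness, [win_transfer]: if [win k n p] holds, it also holds, in every
      abstraction of sufficiently small conservatism, for all cells that meet a
      small ball around [p].  This is an induction on [k].  A cell with finite
      cost has small diameter and its successors are close to [F(p, u)], so they
      meet winning balls around points of [F(p, u)]; the costs of the abstraction
      exceed the original ones by less than the spacing of the lattice, that is,
      not at all.

    Given a compact [N] with [sup V(N)] finite, choose [n] with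
    [lambda * n <= sup V(N)] such that no multiple of [lambda] above [lambda * n] is
    at most [sup V(N)].  Completeness and compactness give one [k] with
    [win k n] on all of [N]; robustness and compactness then make all cells that
    meet [N] winning for large [i]; soundness bounds the value function of the
    abstraction there, and the refined optimal controller performs no worse on the
    plant ([refined_value_le]).  So [sup L_i(N) <= lambda * n <= sup V(N)], and
    the other inequality holds since the refined controller is a controller of the
    plant. *)

(** * The lattice of cost values *)

Section Lattice.
Context {R : realType}.
Implicit Types (l d : R) (n m : nat) (e : \bar R).

Definition level l n : \bar R := (l * n%:R)%:E.

(** A spacing of the lattice above each of its levels.  For [l = 0] the only finite
    cost is 0 and every [d > 0] qualifies; this treats [l = 0] and [l > 0] alike. *)
Definition gap l d : Prop :=
  (0 < d)%R /\
  forall e n, multiples l e -> e < level l n + d%:E -> e <= level l n.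

Lemma gap_self l : (0 < l)%R -> gap l l.
Proof.
move=> l0; split=> // e n [->|[k ->]]; first by rewrite /level -EFinD ltNge leey.
rewrite /level -EFinD lte_fin lee_fin -[X in (_ < _ + X)%R]mulr1 -mulrDr.
by rewrite ltr_pM2l// ler_pM2l// natr1 ltr_nat ler_nat.
Qed.

Lemma gap_zero d : (0 < d)%R -> gap 0 d.
Proof.
move=> d0; split=> // e n [->|[k ->]]; first by rewrite /level -EFinD ltNge leey.
by rewrite /level !mul0r.
Qed.

Lemma levelB l n m : (m <= n)%N -> level l m + level l (n - m) = level l n.
Proof. by move=> mn; rewrite /level -EFinD -mulrDr -natrD subnKC. Qed.

Lemma levelD l n m : level l n + level l m = level l (n + m)%N.
Proof. by rewrite /level -EFinD -mulrDr -natrD. Qed.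

Lemma level_le l n m : (0 <= l)%R -> (n <= m)%N -> level l n <= level l m.
Proof. by move=> l0 nm; rewrite lee_fin ler_wpM2l// ler_nat. Qed.

Lemma level_ge0 l n : (0 <= l)%R -> 0 <= level l n.
Proof. by move=> l0; rewrite lee_fin mulr_ge0. Qed.

(** The bound [m <= n] is automatic only for [l > 0]; for [l = 0] the
    representation is not unique and [m] has to be chosen. *)
Lemma multiplesP l e n : (0 <= l)%R -> multiples l e -> e <= level l n ->
  exists2 m, (m <= n)%N & e = level l m.
Proof.
move=> l0 [->|[k ->]]; first by rewrite leye_eq.
have [kn _|/ltnW nk kl] := leqP k n; first by exists k.
exists n => //; apply/le_anti; rewrite kl/= lee_fin ler_wpM2l// ler_nat//.
Qed.

Lemma multiplesD l e f : multiples l e -> multiples l f -> multiples l (e + f).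
Proof.
move=> [->|[k ->]] [->|[j ->]]; rewrite ?addye ?addey//; try by left.
by right; exists (k + j)%N; rewrite -EFinD natrD mulrDr.
Qed.

Lemma gap_leNgt l d e n : gap l d -> multiples l e -> ~ e <= level l n ->
  level l n + d%:E <= e.
Proof. by move=> [_ gp] me h; rewrite leNgt; apply/negP => /(gp _ _ me). Qed.

End Lattice.

Section Sup.
Context {R : realType}.
Implicit Types (A : set \bar R) (M : \bar R).

Lemma nnsup_le A M : 0 <= M -> (forall e, A e -> e <= M) -> nnsup A <= M.
Proof. by move=> M0 AM; apply: ge_ereal_sup => e [->|/AM]. Qed.

Lemma nnsup_ub A e : A e -> e <= nnsup A.
Proof. by move=> Ae; apply: ereal_sup_ubound; right. Qed.

Lemma nnsup_ge0 A : 0 <= nnsup A.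
Proof. by apply: ereal_sup_ubound; left. Qed.

End Sup.

(** * Winning within a budget and a number of steps *)

Section Win.
Context {R : realType} {TX TU : Type} {X : set TX} {U : set TU}.
Variables (P : ocp R X U) (l : R).
Hypothesis l0 : (0 <= l)%R.

(** Worst-case value iteration, read at the level sets: [k] steps, budget [n]. *)
Fixpoint win (k n : nat) (p : TX) : Prop :=
  term_cost P p <= level l n \/
  match k with
  | 0 => False
  | k'.+1 => exists2 u, U u & forall q, P p u q ->
      exists m, [/\ (m <= n)%N, run_cost P p q u <= level l m
                  & win k' (n - m) q]
  end.

Lemma winS k n p : win k n p -> win k.+1 n p.
Proof.
elim: k n p => [n p [h|//]|k IH n p]; first by left.
case=> [h|[u Uu h]]; first by left.
by right; exists u => // q /h[m [mn gm /IH w]]; exists m.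
Qed.

Lemma win_mono k k' n p : (k <= k')%N -> win k n p -> win k' n p.
Proof.
by move=> /subnK <-; elim: (k' - k)%N => // j IH /IH; exact: winS.
Qed.

(** [(n, k)] is the lexicographically least pair at which [p] wins; the budget
    comes first because a move that lowers the budget may raise the least number
    of steps. *)
Definition ranked (k n : nat) (p : TX) : Prop :=
  win k n p /\ forall k' n', win k' n' p ->
    (n < n')%N \/ n = n' /\ (k <= k')%N.

Lemma win_ranked k n p : win k n p -> exists k0 n0, ranked k0 n0 p.
Proof.
move=> w.
have ex1 : exists n, `[< exists k, win k n p >].
  by exists n; apply/asboolP; exists k.
case: (ex_minnP ex1) => n0 /asboolP[k1 w1] min_n.
have ex2 : exists k, `[< win k n0 p >] by exists k1; apply/asboolP.
case: (ex_minnP ex2) => k0 /asboolP w0 min_k.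
exists k0, n0; split=> // k' n' w'.
have : (n0 <= n')%N by apply: min_n; apply/asboolP; exists k'.
rewrite leq_eqVlt => /orP[/eqP nn|]; last by left.
by right; split=> //; apply: min_k; apply/asboolP; rewrite nn.
Qed.

Lemma ranked_uniq k n k' n' p :
  ranked k n p -> ranked k' n' p -> k = k' /\ n = n'.
Proof.
move=> [w h] [w' h'].
have := h _ _ w'; have := h' _ _ w.
move=> [a|[e a]] [b|[e' b]].
- by move: (ltn_trans a b); rewrite ltnn.
- by rewrite e' ltnn in a.
- by rewrite e ltnn in b.
- by split=> //; apply/eqP; rewrite eqn_leq a b.
Qed.

(** At the least pair the alternatives of [win] exclude each other: if [k] is
    positive, stopping now is too expensive. At losing states anything goes. *)
Definition good_move (p : TX) (uv : TU * bool) : Prop :=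
  U uv.1 /\ forall k n, ranked k n p ->
    if uv.2 then is_true (term_cost P p <= level l n)
    else exists2 k', k = k'.+1 & forall q, P p uv.1 q ->
      exists m, [/\ (m <= n)%N, run_cost P p q uv.1 <= level l m
                  & win k' (n - m) q].

Lemma good_move_ex p : exists uv, good_move p uv.
Proof.
have [u0 Uu0] := inputs_nonempty P.
have [[k [n rk]]|nrk] := pselect (exists k n, ranked k n p); last first.
  by exists (u0, true); split=> // k n rk; case: nrk; exists k, n.
have [] := rk; case: k rk => [|k] rk.
  move=> [h|//] _; exists (u0, true); split=> //= k n' rk'.
  by have [_ <-] := ranked_uniq rk rk'.
move=> [h|[u Uu h]] _.
  exists (u0, true); split=> //= k' n' rk'.
  by have [_ <-] := ranked_uniq rk rk'.
exists (u, false); split=> //= k' n' rk'.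
by have [<- <-] := ranked_uniq rk rk'; exists k.
Qed.

Definition greedy : controller TX TU :=
  {| ctl_state := unit; ctl_init := setT; ctl_meas := TX; ctl_emb := id;
     ctl_input := U;
     ctl_map := fun _ p => [set w | good_move p (w.1.2, w.2)] |}.

Lemma greedy_controller : is_controller X U greedy.
Proof.
split=> //=.
- by exists tt.
- by split=> //; exact: (inputs_nonempty P).
- by move=> _ p; have [[u v] h] := good_move_ex p; exists (tt, u, v).
- by move=> _ p [[? u] v] [].
Qed.

(** Lexicographic induction on the budget and the number of steps: after a good
    move either the budget has dropped or it is the same with fewer steps. *)
Lemma greedy_run u v x :
  behavior greedy P (u, v, x) -> forall n k t, win k n (x t) ->
  exists T, [/\ (t <= T)%N, v T, forall s, (t <= s < T)%N -> ~~ v s &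
    term_cost P (x T) +
      \sum_(t <= s < T) run_cost P (x s) (x s.+1) (u s) <= level l n].
Proof.
move=> [[z [_ _ H]] [Uu Xx F]]; elim/ltn_ind => n IHn; elim/ltn_ind => k IHk t w.
have [k0 [n0 rk]] := win_ranked w.
have le0 := rk.2 _ _ w.
have n0n : (n0 <= n)%N by case: le0 => [/ltnW|[->]].
have /= [_ /(_ _ _ rk)] := H t.
case: ifPn => [vt Gt|vt [k' kE /(_ _ (F t))[m [mn gm w']]]].
  exists t; split=> //; first by move=> s /andP[a /(leq_ltn_trans a)]; rewrite ltnn.
  rewrite big_geq// adde0; apply: (le_trans Gt).
  by apply: level_le.
have [T [tT vT vs JT]] : exists T, [/\ (t.+1 <= T)%N, v T,
    forall s, (t.+1 <= s < T)%N -> ~~ v s & term_cost P (x T) +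
      \sum_(t.+1 <= s < T) run_cost P (x s) (x s.+1) (u s) <= level l (n0 - m)].
  have : (n0 - m <= n)%N by exact: leq_trans (leq_subr _ _) n0n.
  rewrite leq_eqVlt => /orP[/eqP nE|lt]; last exact: IHn lt _ _ w'.
  rewrite nE in w' *; apply: IHk w'.
  have n0E : n0 = n by apply/eqP; rewrite eqn_leq n0n -{1}nE leq_subr.
  by case: le0 => [|[_]]; rewrite ?n0E ?ltnn// kE.
exists T; split=> //; first exact: ltnW.
  move=> s /andP[]; rewrite leq_eqVlt => /orP[/eqP<-//|ts sT].
  by apply: vs; rewrite ts.
rewrite big_ltn// addeCA.
apply: (@le_trans _ _ (level l n0)); last exact: level_le.
by rewrite -(levelB l mn) leeD.
Qed.

Lemma cost_stop (u : nat -> TU) (v : nat -> bool) (x : nat -> TX) T : v T ->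
    (forall s, (s < T)%N -> ~~ v s) ->
  cost P (u, v, x) =
  term_cost P (x T) + \sum_(0 <= s < T) run_cost P (x s) (x s.+1) (u s).
Proof.
move=> vT vs; rewrite /cost; case: pselect => [ex|nex]; last by case: nex; exists T.
suff -> : ex_minn ex = T by [].
case: ex_minnP => S vS minS; apply/eqP; rewrite eqn_leq minS//= leqNgt.
by apply/negP => /vs; rewrite vS.
Qed.

Lemma win_value k n p : win k n p -> value P p <= level l n.
Proof.
move=> w; apply: (@le_trans _ _ (closed_loop_value P greedy p)).
  by apply: ereal_inf_lbound; exists greedy; split=> //; exact: greedy_controller.
apply: nnsup_le; first exact: level_ge0.
move=> _ [[[u v] x] [B x0] <-]; rewrite -x0 in w.
have [T [_ vT vs JT]] := greedy_run B w.
by rewrite (cost_stop _ _ vT vs).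
Qed.

End Win.

(** * Compactness and semi-continuity *)

Section Compactness.
Context {R : realType}.

Lemma compact_increasing (T : topologicalType) (K : set T)
    (Q : nat -> T -> Prop) :
  compact K -> (forall k k' y, (k <= k')%N -> Q k y -> Q k' y) ->
  (forall y, K y -> exists k, \forall z \near y, Q k z) ->
  exists k, K `<=` Q k.
Proof.
move=> /compact_near_coveringP cK Qmono Qloc.
have [k _ h] : \forall k \near \oo, K `<=` Q k.
  apply: cK => y /Qloc[k yk].
  exists ([set z | Q k z], [set j | (k <= j)%N]); first by split=> //; exact: nbhs_infty_ge.
  by move=> [z j] [/= Qz kj]; exact: Qmono Qz.
by exists k; apply: h => /=.
Qed.

(** A Lebesgue number lemma: the radius and the parameter of [Q] are the same
    [e], so that one choice provides all tolerances at once. *)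
Lemma compact_uniform (T : metricType R) (K : set T) (Q : R -> T -> Prop) :
  compact K -> (forall e e' y, (e' <= e)%R -> Q e y -> Q e' y) ->
  (forall y, K y -> exists2 e : R, (0 < e)%R & forall z, (mdist y z < e)%R -> Q e z) ->
  exists2 e : R, (0 < e)%R &
    forall y z, K y -> (mdist y z < e)%R -> Q e z.
Proof.
move=> cK Qmono Qloc.
(* Radii of the form 1/(k+1) turn the claim into an increasing open cover. *)
pose Q' k y := forall z, (mdist y z < k.+1%:R^-1)%R -> Q k.+1%:R^-1%R z.
have [k h] : exists k, K `<=` Q' k; last first.
  by exists (k.+1%:R^-1)%R => // y z /h; exact.
apply: compact_increasing => // [k k' y kk' h z yz|y /Qloc[e e0 he]].
  have kk : (k'.+1%:R^-1 <= k.+1%:R^-1 :> R)%R by rewrite lef_pV2 ?posrE// ler_nat.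
  exact/(Qmono _ _ _ kk)/h/(lt_le_trans yz).
have [k ke] : exists k, (k.+1%:R^-1 < e / 2 :> R)%R.
  by exists (Num.truncn (e / 2)^-1); rewrite invf_plt ?posrE ?divr_gt0// truncnS_gt.
exists k; apply/nbhs_ballP; exists (e / 2)%R; first by rewrite /= divr_gt0.
move=> z; rewrite ballEmdist/= => yz w zw.
have /he : (mdist y w < e)%R.
  rewrite (le_lt_trans (metric_triangle y z w))// [ltRHS]splitr.
  by rewrite ltrD// (lt_trans zw).
by apply: Qmono; rewrite (le_trans (ltW ke))// ler_pdivrMr// ler_peMr ?ltW// ltr1n.
Qed.

End Compactness.

Section Semicontinuity.
Context {R : realType}.

(** The hypograph is closed, hence its complement is a neighbourhood of [(x, c)];
    the slice at height [c] is the claim. *)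
Lemma usc_fun_lt (T : topologicalType) (f : T -> \bar R) x c :
  usc_fun f -> f x < c%:E -> \forall y \near x, f y < c%:E.
Proof.
move=> /closed_openC op fx.
have : nbhs (x, c) (~` [set xc : T * R | xc.2%:E <= f xc.1]).
  by apply: open_nbhs_nbhs; split=> //=; apply/negP; rewrite -ltNge.
move=> [[A B] /= [xA /nbhs_singleton Bc] AB].
apply: filterS xA => y Ay; rewrite ltNge; apply/negP.
exact: (AB (y, c)).
Qed.

Lemma usc_setval_ball (S : topologicalType) (T : metricType R) (f : S -> set T)
    (s : S) (e : R) : (0 < e)%R -> usc_setval f ->
  \forall s' \near s, forall y, f s' y -> exists2 q, f s q & (mdist q y < e)%R.
Proof.
move=> e0 uf; pose O := \bigcup_(q in f s) (ball q e)^°.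
have /uf/closed_openC op : closed (~` O).
  by apply/open_closedC/bigcup_open => q _; exact: open_interior.
have : nbhs s (~` [set a | f a `&` ~` O !=set0]).
  apply: open_nbhs_nbhs; split=> // -[y [fy]]; apply; exists y => //.
  exact: nbhsx_ballx.
apply: filterS.
move=> s' ns y fy; have [q fq /interior_subset] : O y.
  by apply: contrapT => Oy; apply: ns; exists y.
by rewrite ballEmdist; exists q.
Qed.

End Semicontinuity.

(** * Completeness: losing states cost more than the budget *)

Section Metric.
Context {R : realType} {X U : metricType R}.
Variables (P : ocp R [set: X] [set: U]) (l d : R).
Hypotheses (l0 : (0 <= l)%R) (gp : gap l d).
Hypothesis F_compact : forall (p : X) (u : U), compact (P p u).
Hypothesis g_usc : usc_fun (fun w : X * X * U => run_cost P w.1.1 w.1.2 w.2).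
Hypothesis G_usc : usc_fun (term_cost P).
Hypothesis F_usc : usc_setval (fun w : X * U => P w.1 w.2).
Hypothesis P_mult : costs_in P (multiples l).

Lemma level_ltD n : level l n < (l * n%:R + d)%:E.
Proof. by rewrite lte_fin ltrDl gp.1. Qed.

(** Here the lattice enters: [f <= lambda * n] is the same as
    [f < lambda * n + d], which is an open condition. *)
Lemma term_cost_open n p : term_cost P p <= level l n ->
  \forall q \near p, term_cost P q <= level l n.
Proof.
move=> /le_lt_trans/(_ (level_ltD n))/(usc_fun_lt G_usc).
by apply: filterS => q; rewrite EFinD; apply: gp.2; exact: P_mult.1.
Qed.

Lemma run_cost_open n p q u : run_cost P p q u <= level l n ->
  exists2 e : R, (0 < e)%R & forall p' q' u',
    (mdist p p' < e)%R -> (mdist q q' < e)%R -> (mdist u u' < e)%R ->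
    run_cost P p' q' u' <= level l n.
Proof.
move=> /le_lt_trans/(_ (level_ltD n)) h.
have /nbhs_ballP[e e0 he] := @usc_fun_lt _ _ _ (p, q, u) _ g_usc h.
exists e => // p' q' u' pp qq uu.
apply: gp.2; first exact: P_mult.2.
by rewrite /level -EFinD; apply: (he (p', q', u')); split; [split|]; rewrite ballEmdist.
Qed.

(** The input [u] of the winning move at [p] also works at nearby states: their
    successors are close to the compact set [F(p, u)], on a uniform neighbourhood
    of which the remaining game is won. *)
Lemma win_open k n p : win P l k n p -> \forall q \near p, win P l k n q.
Proof.
elim: k n p => [|k IH] n p.
  by move=> [/term_cost_open|//]; apply: filterS => q; left.
move=> [/term_cost_open|[u _ h]]; first by apply: filterS => q; left.
pose Q e y := exists m, [/\ (m <= n)%N,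
  forall p', (mdist p p' < e)%R -> run_cost P p' y u <= level l m
  & win P l k (n - m) y].
have [e e0 he] : exists2 e : R, (0 < e)%R &
    forall y z, P p u y -> (mdist y z < e)%R -> Q e z.
  apply: compact_uniform => //.
    move=> e e' y ee [m [mn gm w]]; exists m; split=> // p' pp.
    by apply: gm; exact: lt_le_trans ee.
  move=> q /h[m [mn /run_cost_open[e e0 ge] /IH]].
  move=> /nbhs_ballP[e' /= e'0 we].
  exists (Num.min e e')%R; first by rewrite lt_min e0.
  move=> z; rewrite lt_min => /andP[z1 z2].
  exists m; split=> //; last by apply: we; rewrite ballEmdist.
  move=> p'; rewrite lt_min => /andP[p1 _].
  by apply: ge => //; rewrite mdistxx.
have /nbhs_ballP[e1 /= e10 Fe] := @usc_setval_ball _ _ _ _ (p, u) _ e0 F_usc.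
apply/nbhs_ballP; exists (Num.min e e1)%R; first by rewrite /= lt_min e0.
move=> p'; rewrite ballEmdist/= lt_min => /andP[p1 p2].
right; exists u => // y Fy.
have [|q Fq qy] := Fe (p', u) _ y Fy.
  by split; rewrite /= ballEmdist//= mdistxx.
have [m [mn gm w]] := he _ _ Fq qy.
by exists m; split=> //; exact: gm.
Qed.

(** Were every successor winning for some number of steps, compactness of
    [F(p, u)] would yield a common number of steps, and [p] would be winning. *)
Lemma lose_step n p u : (forall k, ~ win P l k n p) ->
  exists2 q, P p u q & forall m k, (m <= n)%N ->
    run_cost P p q u <= level l m -> ~ win P l k (n - m) q.
Proof.
move=> lose; apply: contrapT => nq.
have [k h] : exists k, P p u `<=` [set q | exists m, [/\ (m <= n)%N,
    run_cost P p q u <= level l m & win P l k (n - m) q]].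
  apply: compact_increasing => //.
    by move=> k k' y kk [m [mn gm w]]; exists m; split=> //; exact: win_mono w.
  move=> q Fq.
  have [m [k [mn gm w]]] : exists m k, [/\ (m <= n)%N,
      run_cost P p q u <= level l m & win P l k (n - m) q].
    apply: contrapT => nm; apply: nq; exists q => // m k mn gm w.
    by apply: nm; exists m, k.
  exists k; have [e e0 ge] := run_cost_open gm.
  have := win_open w; have : nbhs q (ball q e) by exact: nbhsx_ballx.
  apply: filterS2 => z; rewrite ballEmdist => qz wz.
  by exists m; split=> //; apply: ge => //; rewrite mdistxx.
by apply: (lose k.+1); right; exists u.
Qed.

(** The plant answers each input of the controller by a losing successor.  The
    run is built together with the controller state and the cost spent so far;
    stopping at a losing state exceeds the budget, and so does never stopping. *)
Lemma lose_cost (C : controller X U) n p : is_controller setT setT C ->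
  (forall k, ~ win P l k n p) ->
  exists2 w, behavior_from C P p w & level l n + d%:E <= cost P w.
Proof.
move=> [[z0 Cz0] _ [_ _] Hne Hin] lose.
(* As long as the cost [s.2] spent so far is within budget, the state is losing
   for what remains of it. *)
pose inv (s : ctl_state C * X * \bar R) := multiples l s.2 /\
  (s.2 <= level l n -> exists m, [/\ (m <= n)%N, s.2 = level l m
    & forall k, ~ win P l k (n - m) s.1.2]).
pose step (s s' : ctl_state C * X * \bar R) (uv : U * bool) :=
  [/\ ctl_map C s.1.1 (ctl_emb C s.1.2) (s'.1.1, uv.1, uv.2),
      P s.1.2 uv.1 s'.1.2, s'.2 = s.2 + run_cost P s.1.2 s'.1.2 uv.1
    & inv s -> inv s'].
have next s : exists s', exists uv, step s s' uv.
  case: s => [[z x] S]; have [[[z' u] v] Hz] := Hne z (ctl_emb C x).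
  suff [q [Fq iq]] : exists q, P x u q /\
      (inv (z, x, S) -> inv (z', q, S + run_cost P x q u)).
    by exists (z', q, S + run_cost P x q u), (u, v).
  have [Sn|Sn] := pselect (exists m, [/\ (m <= n)%N, S = level l m
      & forall k, ~ win P l k (n - m) x]); last first.
    have [q Fq] : P x u !=set0 by exact: trans_strict.
    exists q; split=> // -[mS iS]; split; first by apply: multiplesD => //; exact: P_mult.2.
    move=> /= le; exfalso; apply: Sn; apply: iS.
    by apply: le_trans le; rewrite leeDl// run_cost_ge0.
  have [m [mn -> wx]] := Sn.
  have [q Fq hq] := lose_step u wx; exists q; split=> // _.
  have mg : multiples l (run_cost P x q u) by exact: P_mult.2.
  split; first by apply: multiplesD => //; right; exists m.
  rewrite /= -(levelB _ mn) leeD2lE// => /(multiplesP l0 mg)[j jn gE].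
  exists (m + j)%N; split.
  - by rewrite -leq_subRL.
  - by rewrite gE levelD.
  - by move=> k; rewrite subnDA; apply: hq => //; rewrite gE.
have [f [f0 fS]] := dependent_choice (fun s => cid (next s)) (z0, p, 0).
have [uv huv] := choice fS.
have invf t : inv (f t).
  elim: t => [|t IH]; last by have [_ _ _] := huv t; exact.
  rewrite f0; split; first by right; exists 0%N; rewrite mulr0.
  by move=> _; exists 0%N; rewrite subn0 /level mulr0.
pose u t := (uv t).1; pose v t := (uv t).2; pose x t := (f t).1.2.
have sumf T : (f T).2 = \sum_(0 <= s < T) run_cost P (x s) (x s.+1) (u s).
  elim: T => [|T IH]; first by rewrite big_geq// f0.
  by rewrite big_nat_recr//= -IH; have [_ _ ->] := huv T.
exists (u, v, x).
  split; last by rewrite /= /x f0.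
  split; last by split=> // t; have [] := huv t.
  exists (fun t => (f t).1.1); split.
  - by move=> t; have [/Hin] := huv t.
  - by rewrite f0.
  - by move=> t; have [] := huv t.
have [ex|nex] := pselect (exists t, v t); last first.
  by rewrite /cost; case: pselect => // _; rewrite leey.
have [T vT minT] := ex_minnP ex.
have vs s : (s < T)%N -> ~~ v s.
  by move=> sT; apply/negP => /minT; rewrite leqNgt sT.
rewrite (cost_stop P u x vT vs) -sumf.
have [mf hf] := invf T.
have mG : multiples l (term_cost P (x T)) by exact: P_mult.1.
(* A cost within budget would let the run stop in a state losing for the rest. *)
apply: (gap_leNgt gp); first exact: multiplesD.
move=> le.
have [|m [mn fE lo]] := hf.
  by apply: le_trans le; rewrite leeDr// term_cost_ge0.
apply: (lo 0%N); left; move: le.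
by rewrite -(levelB _ mn) fE addeC leeD2lE.
Qed.

Lemma value_lt_win n p : value P p < level l n + d%:E ->
  exists k, win P l k n p.
Proof.
rewrite ltNge => nle; apply: contrapT => lose; case/negP: nle.
apply: le_ereal_inf_tmp => _ [C [cC ->]].
have [|w Bw] := lose_cost cC (n := n) (p := p).
  by move=> k w; apply: lose; exists k.
by move=> /le_trans; apply; apply: nnsup_ub; exists w.
Qed.

End Metric.

(** * Robustness: winning cells of fine abstractions *)

Section Transfer.
Context {R : realType} {X U : metricType R}.
Variables (P : ocp R [set: X] [set: U]) (l d : R).
Hypotheses (l0 : (0 <= l)%R) (gp : gap l d).
Hypothesis F_compact : forall (p : X) (u : U), compact (P p u).
Hypothesis g_usc : usc_fun (fun w : X * X * U => run_cost P w.1.1 w.1.2 w.2).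
Hypothesis G_usc : usc_fun (term_cost P).
Hypothesis F_usc : usc_setval (fun w : X * U => P w.1 w.2).
Hypothesis P_mult : costs_in P (multiples l).

(** An excess smaller than the spacing of the lattice is no excess. *)
Lemma conservative_level (r : R) n (A : set \bar R) e : (r < d)%R ->
  multiples l e -> e <= r%:E + nnsup A -> (forall a, A a -> a <= level l n) ->
  e <= level l n.
Proof.
move=> rd me eA An; apply: gp.2 => //; apply: (le_lt_trans eA).
apply: (@le_lt_trans _ _ (r%:E + level l n)); last first.
  by rewrite addeC /level -!EFinD lte_fin ltrD2l.
by apply: leeD2l; apply: nnsup_le => //; exact: level_ge0.
Qed.

Section Cell.
Context {X2 : set (set X)} {U2 : set U} {P2 : ocp R X2 U2} {r : R}.
Hypothesis P2P : abstraction_of_conservatism P2 P r%:E.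

(** A winning state has a finite terminal or running cost, which is the premise
    under which conservatism controls the successors and the diameter of a cell. *)
Lemma win_cell k n y (O : set X) (u : U) :
  win P l k n y -> X2 O -> O y -> U2 u ->
  (P2 O u `<=` [set O' | X2 O' /\
      set_dist O' (\bigcup_(p in O) P p u) <= r%:E]) /\
  (forall y1 y2, O y1 -> O y2 -> (mdist y1 y2 <= r)%R).
Proof.
move=> w XO Oy Uu; have [_ _ [_ /(_ _ _ _ XO XO Uu)[_ _ _ h]]] := P2P.
have [A1|FO dO] := h; last first.
  split=> // y1 y2 O1 O2; rewrite -lee_fin; apply: le_trans dO.
  by apply: nnsup_ub; exists y1 => //; exists y2.
suff [e] : exists2 e, ((term_cost P @` O) `|`
    [set e | exists p q w, O p /\ e = run_cost P p q w]) e & e != +oo.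
  by rewrite A1 => -> /eqP.
case: k w => [[Gy|//]|k [Gy|[u' _ hu]]].
- by exists (term_cost P y); [left; exists y|apply: contraTneq Gy => ->].
- by exists (term_cost P y); [left; exists y|apply: contraTneq Gy => ->].
have [q Fq] : P y u' !=set0 by exact: trans_strict.
have [m [_ gm _]] := hu _ Fq.
exists (run_cost P y q u'); last by apply: contraTneq gm => ->.
by right; exists y, q, u'.
Qed.

End Cell.

(** One parameter [e] bounds the conservatism here and the radius of the ball
    in [win_transfer], as needed for [compact_uniform]. *)
Definition near_win k n (e : R) (p : X) : Prop :=
  forall (X2 : set (set X)) (U2 : set U) (P2 : ocp R X2 U2) (r : R),
    abstraction_of_conservatism P2 P r%:E -> costs_in P2 (multiples l) ->
    (r < e)%R -> forall O, X2 O -> O p -> win P2 l k n O.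

(** Let [u] win at [p], let [y] be close to [p] and let [y] lie in a cell [O] of a
    fine abstraction; pick an available input [u'] close to [u].  Every successor
    cell of [O] under [u'] is close to [F(O, u')], hence to [F(p, u)], hence it
    contains a point [x] at which the induction hypothesis applies; as that cell is
    small too, its running cost is bounded by the cost near [(p, x, u)]. *)
Lemma win_transfer k n p : win P l k n p ->
  exists2 e : R, (0 < e)%R & forall y, (mdist p y < e)%R -> near_win k n e y.
Proof.
have wopen k' n' p' : win P l k' n' p' -> exists2 e : R, (0 < e)%R &
    forall y, (mdist p' y < e)%R -> win P l k' n' y.
  move=> /(win_open gp F_compact g_usc G_usc F_usc P_mult).
  move=> /nbhs_ballP[e e0 he]; exists e => // y py.
  by apply: he; rewrite ballEmdist.
have termcase k' n' p' : term_cost P p' <= level l n' -> exists2 e : R, (0 < e)%R &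
    forall y, (mdist p' y < e)%R -> near_win k' n' e y.
  move=> Gp; have /nbhs_ballP[e /= e0 he] := term_cost_open gp G_usc P_mult Gp.
  have dl : (0 < d)%R by exact: gp.1.
  exists (Num.min (e / 2) d)%R; first by rewrite lt_min divr_gt0.
  move=> y; rewrite lt_min => /andP[py _] X2 U2 P2 r P2P m2.
  rewrite lt_min => /andP[re rd] O XO Oy.
  have [u Uu] := inputs_nonempty P2.
  have wy : win P l 0 n' y.
    left; apply: he; rewrite ballEmdist /=; apply: lt_trans py _.
    by rewrite gtr_pMr// invf_lt1// ltr1n.
  have [_ dO] := win_cell P2P wy XO Oy Uu.
  have [_ _ [_ /(_ _ _ _ XO XO Uu)[_ GO _ _]]] := P2P.
  suff GOn : term_cost P2 O <= level l n' by case: (k') => [|?]; left.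
  apply: (conservative_level rd) GO _; first exact: m2.1.
  move=> _ [y' Oy' <-]; apply: he; rewrite ballEmdist /=.
  rewrite (le_lt_trans (metric_triangle p' y y'))// [ltRHS]splitr.
  by rewrite ltrD// (le_lt_trans _ re)// dO.
elim: k n p => [|k IH] n p; first by move=> [|//]; exact: termcase.
move=> w; have [e1 e10 we] := wopen _ _ _ w.
case: w => [|[u _ hu]]; first exact: termcase.
(* [Q] collects what a successor [y] must satisfy, with a common tolerance. *)
pose Q e y := exists m, [/\ (m <= n)%N, win P l k (n - m) y, near_win k (n - m) e y
  & forall p' y' u', (mdist p p' < e)%R -> (mdist y y' < e)%R ->
    (mdist u u' < e)%R -> run_cost P p' y' u' <= level l m].
have [e2 e20 Qe] : exists2 e : R, (0 < e)%R &
    forall q y, P p u q -> (mdist q y < e)%R -> Q e y.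
  apply: compact_uniform => //.
    move=> e e' y ee [m [mn wy ny gm]]; exists m; split=> //.
      move=> X2 U2 P2 r P2P m2 re; apply: (ny _ _ P2 r) => //.
      exact: lt_le_trans ee.
    by move=> p' y' u' pp yy uu; apply: gm; exact: lt_le_trans ee.
  move=> q /hu[m [mn gm wq]].
  have [ea ea0 wa] := wopen _ _ _ wq.
  have [eb eb0 nb] := IH _ _ wq.
  have [ec ec0 gc] := run_cost_open gp g_usc P_mult gm.
  exists (Num.min (Num.min ea eb) (ec / 2))%R; first by rewrite !lt_min ea0 eb0 divr_gt0.
  move=> z; rewrite !lt_min => /andP[/andP[za zb] zc].
  exists m; split=> //; first exact: wa.
    move=> X2 U2 P2 r P2P m2; rewrite !lt_min => /andP[/andP[_ rb] _].
    exact: (nb _ zb _ _ P2 r).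
  have ec2 : (ec / 2 <= ec)%R by rewrite ler_pdivrMr// ler_peMr ?ltW// ltr1n.
  move=> p' y' u'; rewrite !lt_min => /andP[_ pc] /andP[_ yc] /andP[_ uc].
  apply: gc; [exact: lt_le_trans ec2| |exact: lt_le_trans ec2].
  by rewrite (le_lt_trans (metric_triangle q z y'))// [ltRHS]splitr ltrD.
have /nbhs_ballP[e3 /= e30 Fe] :=
  @usc_setval_ball _ _ _ _ (p, u) (e2 / 2)%R ltac:(by rewrite divr_gt0) F_usc.
have dl : (0 < d)%R by exact: gp.1.
exists (Num.min (Num.min e1 d) (Num.min (e2 / 2) (e3 / 2)))%R.
  by rewrite !lt_min e10 dl !divr_gt0.
move=> y; rewrite !lt_min => /andP[/andP[py1 _] /andP[py2 py3]].
move=> X2 U2 P2 r P2P m2.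
rewrite !lt_min => /andP[/andP[r1 rd] /andP[r2 r3]] O XO Oy.
have r0 : (0 <= r)%R by case: P2P => _ _ [].
have [u' Uu' uu'] : exists2 u', U2 u' & (mdist u u' <= r)%R.
  have [u1 Uu1] := inputs_nonempty P2.
  have [_ _ [_ /(_ _ _ _ XO XO Uu1)[cov _ _ _]]] := P2P.
  have : [set: U] u by []; rewrite cov => -[u' Uu' h].
  by exists u' => //; rewrite metric_sym.
have [FO dO] := win_cell P2P (we _ py1) XO Oy Uu'.
(* The tolerances: [r] bounds the diameter of [O] and the distance of [u'] from [u];
   [e3] controls [F] near [(p, u)], and [e2] the costs and cells near [F(p, u)]. *)
have half (a : R) : (0 < a)%R -> (a / 2 < a)%R.
  by move=> a0; rewrite gtr_pMr// invf_lt1// ltr1n.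
have Onear p' : O p' -> (mdist p p' < e2)%R /\ (mdist p p' < e3)%R.
  move=> Op'; split; rewrite (le_lt_trans (metric_triangle p y p'))// [ltRHS]splitr.
    by rewrite ltrD// (le_lt_trans _ r2)// dO.
  by rewrite ltrD// (le_lt_trans _ r3)// dO.
right; exists u' => // O' /FO[XO' dOO'].
have [_ [x O'x [y' [p' Op' Fy' <-]]] xy'] :
    exists2 e, [set (mdist x y0)%:E | x in O' & y0 in \bigcup_(p in O) P p u'] e &
      e < (e2 / 2)%:E.
  by apply: ereal_inf_lt; apply: le_lt_trans dOO' _; rewrite lte_fin.
rewrite lte_fin in xy'.
have [|q Fq qy'] := Fe (p', u') _ y' Fy'.
  split; rewrite /= ballEmdist /=; first by have [] := Onear _ Op'.
  by rewrite (le_lt_trans uu')// (lt_trans r3)// half.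
have qx : (mdist q x < e2)%R.
  rewrite (le_lt_trans (metric_triangle q y' x))// [ltRHS]splitr ltrD//.
  by rewrite metric_sym.
have [m [mn wx nx gm]] := Qe _ _ Fq qx.
have re2 : (r < e2)%R by rewrite (lt_trans r2)// half.
have [_ dO'] := win_cell P2P wx XO' O'x Uu'.
exists m; split=> //; last exact: (nx _ _ P2 r).
have [_ _ [_ /(_ _ _ _ XO XO' Uu')[_ _ gO _]]] := P2P.
apply: (conservative_level rd) gO _; first exact: m2.2.
move=> _ [a Oa [b O'b <-]]; apply: gm.
- by have [] := Onear _ Oa.
- by rewrite (le_lt_trans _ re2)// dO'.
- by rewrite (le_lt_trans uu').
Qed.

End Transfer.

(** * Refined controllers *)

Section Refinement.
Context {R : realType} {TX TU : Type}.
Context {X2 : set (set TX)} {U1 U2 : set TU}.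
Variables (P1 : ocp R [set: TX] U1) (P2 : ocp R X2 U2).
Variable C : controller (set TX) TU.
Hypotheses (P21 : abstraction P2 P1) (cC : is_controller X2 U2 C).

Let refined : controller TX TU :=
  serial C (fun p => ctl_emb C @` memb X2 p).

Lemma refined_controller : is_controller setT U1 refined.
Proof.
have [cov _ [_ U21 _ _ _]] := P21.
have [C0 _ [Ci CU] Cne Cin] := cC.
split=> //=; first by split=> //; exact: subset_trans U21.
  move=> z p; have [Om XO Op] : (\bigcup_(O in X2) O) p by rewrite cov.
  by have [w Hw] := Cne z (ctl_emb C Om); exists w; exists (ctl_emb C Om) => //; exists Om.
by move=> z p w [_ _ /Cin].
Qed.

(** A run of the refined loop passes, at each time, through the cell whose symbol
    the controller has acted on; these cells form a run of the abstract loop,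
    because successors of states only lie in successor cells. *)
Lemma refined_cost p u v x : behavior_from refined P1 p (u, v, x) ->
  exists2 y : nat -> set TX, memb X2 p (y 0%N) &
    behavior C P2 (u, v, y) /\ cost P1 (u, v, x) <= cost P2 (u, v, y).
Proof.
move=> [[[z [Cu Cz H]] [Uu _ F]] /= x0].
have [_ _ [_ _ GG gg FF]] := P21.
have [_ _ [_ CU] _ _] := cC.
have /choice [y hy] : forall t, exists O, memb X2 (x t) O /\
    ctl_map C (z t) (ctl_emb C O) (z t.+1, u t, v t).
  by move=> t; have [_ [Om mO <-] HO] := H t; exists Om.
have my t : memb X2 (x t) (y t) by have [] := hy t.
exists y; first by rewrite -x0.
split.
  split; first by exists z; split=> // t; have [] := hy t.
  split=> [t|t|t]; [exact: (CU _ (Cu t))|by have [] := my t|].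
  by apply: (FF (x t) (y t) (u t)) => //; [exact: (CU _ (Cu t))|exists (x t.+1)].
rewrite /cost; case: pselect => // ex; apply: leeD; first exact: GG.
by apply: lee_sum => t _; apply: gg => //; exact: (CU _ (Cu t)).
Qed.

Lemma refined_value_le p M : 0 <= M ->
  (forall O, memb X2 p O -> closed_loop_value P2 C O <= M) ->
  closed_loop_value P1 refined p <= M.
Proof.
move=> M0 h; apply: nnsup_le => // _ [[[u v] x] Bw <-].
have [y my [By /le_trans]] := refined_cost Bw; apply.
by apply: le_trans (h _ my); apply: nnsup_ub; exists (u, v, y).
Qed.

End Refinement.

(** * Conclusion *)

(** For [l = 0] the level is [0] and the spacing [c + 1] is chosen to exceed [c];
    for [l > 0] the level is [c] rounded down to the lattice. *)
Lemma gap_exists (R : realType) (l : R) (c : \bar R) : (0 <= l)%R -> 0 <= c ->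
  c < +oo ->
  exists n d, [/\ gap l d, level l n <= c & c < level l n + d%:E].
Proof.
move=> l0 c0 coo; case: c c0 coo => // c; rewrite lee_fin => c0 _.
move: l0; rewrite le_eqVlt => /orP[/eqP <-|l0].
  exists 0%N, (c + 1)%R; split; first by apply: gap_zero; rewrite ltr_wpDl.
    by rewrite lee_fin mul0r.
  by rewrite /level mul0r add0e lte_fin ltrDl.
exists (Num.truncn (c / l)), l; split; first exact: gap_self.
  by rewrite lee_fin mulrC -ler_pdivlMr// truncn_le ?divr_ge0// ltW.
by rewrite /level -EFinD lte_fin -[X in (_ + X)%R]mulr1 -mulrDr natr1 mulrC
  -ltr_pdivrMr// truncnS_gt.
Qed.

Theorem mainTheorem12 (R : realType) (X U : metricType R)
    (P : ocp R [set: X] [set: U])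
    (X_proper : proper_metric X)
    (U_compact : compact [set: U])
    (F_compact : forall (p : X) (u : U), compact (P p u))
    (g_usc : usc_fun (fun w : X * X * U => run_cost P w.1.1 w.1.2 w.2))
    (G_usc : usc_fun (term_cost P))
    (F_usc : usc_setval (fun w : X * U => P w.1 w.2))
    (Xi : nat -> set (set X)) (Ui : nat -> set U)
    (Pi : forall i : nat, ocp R (Xi i) (Ui i))
    (rho : nat -> \bar R)
    (Pi_abs : forall i : nat, abstraction_of_conservatism (Pi i) P (rho i))
    (C : nat -> controller (set X) U)
    (C_opt : forall i : nat, optimal (Pi i) (C i))
    (L : nat -> X -> \bar R)
    (L_def : forall i : nat, L i =
       closed_loop_value P
         (serial (C i) (fun p : X => ctl_emb (C i) @` memb (Xi i) p)))
    (rho_lim : rho i @[i --> \oo] --> 0%:E)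
    (lambda : R) (lambda_ge0 : (0 <= lambda)%R)
    (P_mult : costs_in P (multiples lambda))
    (Pi_mult : forall i : nat, costs_in (Pi i) (multiples lambda)) :
  (forall N : set X, compact N ->
     \forall i \near \oo, nnsup (L i @` N) = nnsup (value P @` N)) /\
  (lambda = 0%R ->
   forall N : set X, compact N -> (forall p, N p -> value P p = 0) ->
     \forall i \near \oo, forall p, N p -> L i p = 0).
Proof.
have main (N : set X) : compact N ->
    \forall i \near \oo, nnsup (L i @` N) = nnsup (value P @` N).
  move=> cN.
  have lower i : nnsup (value P @` N) <= nnsup (L i @` N).
    apply: nnsup_le; first exact: nnsup_ge0.
    move=> _ [p Np <-]; apply: (@le_trans _ _ (L i p)); last by apply: nnsup_ub; exists p.
    have [abs _ _] := Pi_abs i; have [cC _] := C_opt i.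
    apply: ereal_inf_lbound; rewrite L_def; eexists; split; last reflexivity.
    exact: refined_controller abs cC.
  have [coo|] := eqVneq (nnsup (value P @` N)) +oo.
    near=> i; apply/le_anti; rewrite lower andbT coo; exact: leey.
  rewrite -ltey => /(gap_exists lambda_ge0 (nnsup_ge0 _))[n [d [gp nc cn]]].
  have [k Nk] : exists k, N `<=` win P lambda k n.
    apply: compact_increasing => //.
      by move=> k k' y kk'; exact: win_mono.
    move=> p Np; have [|k w] :=
      value_lt_win lambda_ge0 gp F_compact g_usc G_usc F_usc P_mult (n := n) (p := p).
      by apply: le_lt_trans cn; apply: nnsup_ub; exists p.
    exists k; exact: (win_open gp F_compact g_usc G_usc F_usc P_mult).
  have [e e0 he] : exists2 e : R, (0 < e)%R &
      forall p y, N p -> (mdist p y < e)%R -> near_win P lambda k n e y.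
    apply: compact_uniform => //.
      move=> e e' y ee h X2 U2 P2 r P2P m2 re; apply: h P2P m2 _.
      exact: lt_le_trans ee.
    by move=> p /Nk; exact: (win_transfer lambda_ge0 gp F_compact g_usc G_usc F_usc P_mult).
  have rhoe : \forall i \near \oo, rho i < e%:E.
    exact: (rho_lim _ (nbhs_open_ereal_lt (f := cst e) e0)).
  near=> i; apply/le_anti; rewrite lower andbT.
  apply: le_trans nc; apply: nnsup_le; first exact: level_ge0.
  move=> _ [p Np <-].
  have rhoi : rho i < e%:E by near: i.
  have [abs _ _] := Pi_abs i; have [cC opt] := C_opt i.
  rewrite L_def; apply: (refined_value_le abs cC); first exact: level_ge0.
  move=> Om [XO Op]; rewrite opt//; apply: (@win_value _ _ _ _ _ _ _ _ k) => //.
  have := Pi_abs i; case: (rho i) rhoi => [r|//|]; last by move=> _ [].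
  rewrite lte_fin => re absr.
  by apply: (he p p Np _ _ _ _ r); rewrite ?mdistxx.
split=> // _ N cN VN.
have := main N cN; apply: filterS => i sup p Np.
have sup0 : nnsup (value P @` N) <= 0 by apply: nnsup_le => // _ [q /VN -> <-].
apply/le_anti/andP; split; last by rewrite L_def; exact: nnsup_ge0.
by apply: le_trans sup0; rewrite -sup; apply: nnsup_ub; exists p.
Unshelve. all: by end_near.
Qed.
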